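(* Given a $(2,k,v)$-Steiner system with transposed incidence matrix $A^{\mathrm T}$, put $M=\frac{v(v-1)}{k(k-1)}$ and $N=v\left(1+\frac{v-1}{k-1}\right)$, and build an $M\times N$ matrix $\Phi$ as follows. For each $j=1,\dots,v$, let $H_j$ be a (possibly complex) Hadamard matrix of size $1+\frac{v-1}{k-1}$ having an all-ones row; let $\Phi_j$ be the $M\times\left(1+\frac{v-1}{k-1}\right)$ matrix obtained from the $j$th column of $A^{\mathrm T}$ by replacing each of its $\frac{v-1}{k-1}$ one-valued entries with a distinct row of $H_j$ that is not all-ones, and every zero-valued entry with a row of zeros; and let $\Phi=\left(\frac{k-1}{v-1}\right)^{1/2}[\Phi_1\cdots\Phi_v]$. Then $\Phi$ is an equiangular tight frame, meaning $\|\Phi\|_2^2=\frac NM$ and $\mu^2=\frac{N-M}{M(N-1)}$, and has average coherence $\nu\le\frac{\mu}{\sqrt M}$.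
   Context: A $(2,k,v)$-Steiner system ($2\le k\le v$) is a $v$-element set $V$ with a collection of size-$k$ subsets (blocks) such that every $2$-element subset of $V$ lies in exactly one block; then each point lies in $\frac{v-1}{k-1}$ blocks and there are $\frac{v(v-1)}{k(k-1)}$ blocks. Its incidence matrix $A$ has rows indexed by points, columns indexed by blocks, and entry $1$ if the point lies in the block and $0$ otherwise. A (possibly complex) Hadamard matrix is a square matrix with unimodular entries and orthogonal rows. An equiangular tight frame is a full-rank $M\times N$ matrix with unit-norm columns $\varphi_1,\dots,\varphi_N$, pairwise orthogonal rows of equal norm, and $|\langle\varphi_i,\varphi_j\rangle|$ constant over $i\ne j$. $\|\Phi\|_2$ is the spectral norm, $\mu:=\max_{i\ne j}|\langle\varphi_i,\varphi_j\rangle|$ is the worst-case coherence, and $\nu:=\max_i\left|\frac1{N-1}\sum_{j\ne i}\langle\varphi_i,\varphi_j\rangle\right|$ is the average coherence. *)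

(* Defs.v *)
From HB Require Import structures.
From mathcomp Require Import all_boot all_order all_algebra.
From mathcomp Require Import complex classical_sets reals.
Set Implicit Arguments.
Unset Strict Implicit.
Unset Printing Implicit Defensive.
Import Order.TTheory GRing.Theory Num.Theory.
Import ComplexField.Normc.
Local Open Scope ring_scope.
Local Open Scope complex_scope.

Definition steiner_system (k v : nat) (V : finType) (B : {set {set V}}) : Prop :=
  [/\ (2 <= k <= v)%N,
      #|V| = v,
      forall X : {set V}, X \in B -> #|X| = k
    & forall P : {set V}, #|P| = 2 -> exists! X : {set V}, X \in B /\ P \subset X].

(* The truncated divisions below are exact for a Steiner system, and are the
   number of blocks through each point and the total number of blocks
   (steiner_replicationE and steiner_num_blocksE). *)
Definition replication (k v : nat) : nat := ((v - 1) %/ (k - 1))%N.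
Definition num_blocks (k v : nat) : nat := ((v * (v - 1)) %/ (k * (k - 1)))%N.

Lemma steiner_replication_mul (k v : nat) (V : finType) (B : {set {set V}})
    (p : V) :
  steiner_system k v B ->
  (#|[set X in B | p \in X]| * (k - 1) = v - 1)%N.
Proof.
move=> [_ hV hk hP].
transitivity (\sum_(X in B | p \in X) \sum_(q in X :\ p) 1)%N.
  rewrite -sum_nat_const big_mkcond [RHS]big_mkcond /=.
  apply: eq_bigr => X _; rewrite inE.
  case: ifP => // /andP[XB pX].
  by rewrite sum1_card -(hk _ XB) (cardsD1 p X) pX add1n subn1.
rewrite (exchange_big_dep (fun q => q != p)) /=; last first.
  by move=> X q _; rewrite !inE => /andP[].
transitivity (\sum_(q | q != p) 1)%N; last first.
  by rewrite sum1_card -hV subn1 -(cardC1 p).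
apply: eq_bigr => q qp.
have /hP[X [[XB /fintype.subsetP sX] uX]] : #|[set p; q]| = 2.
  by rewrite cards2 eq_sym qp.
rewrite sum1_card (eq_card (B := pred1 X)) ?card1 // => Y.
rewrite !inE unfold_in /= !inE qp /=.
apply/idP/eqP => [/andP[/andP[YB pY] qY] | ->].
  by apply/esym/uX; split=> //; apply/fintype.subsetP => z; rewrite !inE => /orP[] /eqP->.
by rewrite XB !sX // !inE eqxx ?orbT.
Qed.

Lemma steiner_replicationE (k v : nat) (V : finType) (B : {set {set V}})
    (p : V) :
  steiner_system k v B ->
  (k - 1 %| v - 1)%N /\ #|[set X in B | p \in X]| = replication k v.
Proof.
move=> hB; have [/andP[k2 _] _ _ _] := hB.
have k1 : (0 < k - 1)%N by rewrite subn_gt0.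
by rewrite /replication -(steiner_replication_mul p hB) dvdn_mull // mulnK.
Qed.

Lemma steiner_num_blocksE (k v : nat) (V : finType) (B : {set {set V}}) :
  steiner_system k v B ->
  (k * (k - 1) %| v * (v - 1))%N /\ #|B| = num_blocks k v.
Proof.
move=> hB; have [/andP[k2 _] hV hk _] := hB.
have k1 : (0 < k * (k - 1))%N by rewrite muln_gt0 subn_gt0 k2 (leq_trans _ k2).
have E : (#|B| * (k * (k - 1)) = v * (v - 1))%N.
  rewrite mulnA -sum_nat_const.
  transitivity ((\sum_(X in B) \sum_(p in X) 1) * (k - 1))%N.
    by congr (_ * _)%N; apply: eq_bigr => X XB; rewrite sum1_card hk.
  rewrite (exchange_big_dep predT) //= big_distrl /=.
  rewrite -{1}hV -sum_nat_const; apply: eq_bigr => p _.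
  rewrite -(steiner_replication_mul p hB) sum1_card; congr (_ * _)%N.
  by apply: eq_card => X; rewrite !inE.
by rewrite /num_blocks -E dvdn_mull // mulnK.
Qed.

Definition incidence_mx (R : realType) (m n : nat) (V : finType)
    (pt : 'I_m -> V) (bl : 'I_n -> {set V}) : 'M[R[i]]_(m, n) :=
  \matrix_(p, b) (pt p \in bl b)%:R.

Definition l2norm (R : realType) (n : nat) (x : 'cV[R[i]]_n) : R :=
  Num.sqrt (\sum_i normc (x i 0) ^+ 2).

(* dotmx is the standard Hermitian inner product on row vectors,
   conjugate-linear in its second argument. *)
Definition row_inner (R : realType) (m n : nat) (A : 'M[R[i]]_(m, n))
    (i j : 'I_m) : R[i] :=
  dotmx (row i A) (row j A).

Definition col_inner (R : realType) (m n : nat) (A : 'M[R[i]]_(m, n))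
    (i j : 'I_n) : R[i] :=
  dotmx (col i A)^T (col j A)^T.

Definition hadamard (R : realType) (n : nat) (H : 'M[R[i]]_n) : Prop :=
  (forall i j, normc (H i j) = 1) /\
  (forall i j, i != j -> row_inner H i j = 0).

Definition equiangular_tight_frame (R : realType) (M N : nat)
    (Phi : 'M[R[i]]_(M, N)) : Prop :=
  [/\ \rank Phi = minn M N,
      forall j, l2norm (col j Phi) = 1,
      forall i i', i != i' -> row_inner Phi i i' = 0,
      exists a : R, forall i, l2norm (row i Phi)^T = a
    & exists c : R, forall i j, i != j -> normc (col_inner Phi i j) = c].

Definition spectral_norm (R : realType) (M N : nat)
    (Phi : 'M[R[i]]_(M, N)) : R :=
  sup [set l2norm (Phi *m x) | x in [set x : 'cV[R[i]]_N | l2norm x <= 1]]%classic.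

(* In the two maxima below the terms are nonnegative, so starting from 0
   is harmless. *)
Definition worst_case_coherence (R : realType) (M N : nat)
    (Phi : 'M[R[i]]_(M, N)) : R :=
  \big[Num.max/0]_(i < N) \big[Num.max/0]_(j < N | j != i)
    normc (col_inner Phi i j).

Definition average_coherence (R : realType) (M N : nat)
    (Phi : 'M[R[i]]_(M, N)) : R :=
  \big[Num.max/0]_(i < N)
    normc ((N%:R - 1)^-1 * \sum_(j < N | j != i) col_inner Phi i j).

(* f tells which row of H replaces each one-valued entry of a; its values at
   the other entries are irrelevant. *)
Definition admissible_replacement (R : realType) (m n : nat)
    (a : 'cV[R[i]]_m) (H : 'M[R[i]]_n) (f : 'I_m -> 'I_n) : Prop :=
  (forall b b', a b 0 = 1 -> a b' 0 = 1 -> f b = f b' -> b = b') /\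
  (forall b, a b 0 = 1 -> row (f b) H != const_mx 1).

Definition replace_ones (R : realType) (m n : nat)
    (a : 'cV[R[i]]_m) (H : 'M[R[i]]_n) (f : 'I_m -> 'I_n) : 'M[R[i]]_(m, n) :=
  \matrix_(b < m) (if a b 0 == 1 then row (f b) H else 0).

(* The block row [A_0 ... A_(v-1)], with the width of \mxrow recast from
   \sum_(j < v) n to v * n. *)
Definition hconcat (R : realType) (m n v : nat) (A : 'I_v -> 'M[R[i]]_(m, n)) :
    'M[R[i]]_(m, v * n) :=
  castmx (erefl m, etrans (sum_nat_const 'I_v n) (congr1 (muln^~ n) (card_ord v)))
    (\mxrow_(j < v) A j).

Definition frame_size (k v : nat) : nat := (v * (1 + replication k v))%N.

Definition steiner_frame (R : realType) (k v : nat)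
    (A : 'M[R[i]]_(v, num_blocks k v))
    (H : 'I_v -> 'M[R[i]]_(1 + replication k v))
    (f : 'I_v -> 'I_(num_blocks k v) -> 'I_(1 + replication k v)) :
    'M[R[i]]_(num_blocks k v, frame_size k v) :=
  (Num.sqrt ((k - 1)%:R / (v - 1)%:R))%:C *:
    hconcat (fun j => replace_ones (col j A^T) (H j) (f j)).

(* Main.v *)
Require Import Defs.
From mathcomp Require Import all_boot all_order all_algebra.
From mathcomp Require Import complex classical_sets reals.
From mathcomp Require Import ring zify.
Set Implicit Arguments.
Unset Strict Implicit.
Unset Printing Implicit Defensive.
Import Order.TTheory GRing.Theory Num.Theory.
Import ComplexField.Normc.
Local Open Scope complex_scope.
Local Open Scope ring_scope.
Local Open Scope sesquilinear_scope.

(** Write r for the number of blocks through a point. The columns of the frame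
    are indexed by pairs (j, c) of a point and a column of [H j], those with a
    fixed j forming the slice of j, and the scaling factor is r^(-1/2)
    ([steiner_frameE]). Everything follows from the Gram matrices on the two
    sides.

    Rows. The rows of blocks b and b' overlap only in the slices of their
    common points, and there they carry distinct rows of a Hadamard matrix,
    which are orthogonal. The squared norm of a row receives (r + 1) / r
    from each of the k points of its block, in total N / M. So Phi Phi^* = (N / M) I
    ([steiner_tight]). For any matrix with Phi Phi^* = a I, the rank is the
    number of rows ([tight_rank]) and the spectral norm is sqrt a
    ([tight_spectral_norm]), because Phi^* Phi / a is an orthogonal projection.

    Columns. Two columns in the slices of distinct points meet in exactly one
    block, the one joining the points, so that their inner product is a single
    product of unimodular numbers divided by r ([steiner_col_inner_diff]).
    Inside the slice of one point, the r blocks through it use each row of the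
    Hadamard matrix except the all-ones row; two distinct columns of that matrix
    are orthogonal, so removing the all-ones row leaves the inner product -1,
    again divided by r ([steiner_col_inner_same]). Hence the coherence is 1 / r, and the counts
    r (k - 1) = v - 1 and M k = v r turn 1 / r^2 into (N - M) / (M (N - 1))
    ([welch_boundE]).

    Average coherence. A row of a Hadamard matrix other than the all-ones row is
    orthogonal to it, hence sums to 0, so the columns of the frame sum to 0. The
    unit column phi_i then has inner products with the others that add up to -1,
    and the average coherence is exactly 1 / (N - 1)
    ([steiner_row_sum], [balanced_average_coherence]); it is at most
    1 / (r sqrt M) because N - 1 = r (k - 1 + v) and M <= v^2
    ([average_boundE]). *)

(** * Hermitian matrices and norms *)

(** The norm of the numeric field [R[i]] is [normc] embedded back into [R[i]].
    This lemma and the next one pass between the two, so that real-valued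
    moduli can be computed with the general theory of normed fields. *)
Lemma normc_norm (R : realType) (z : R[i]) (c : R) :
  `|z| = c%:C -> normc z = c.
Proof. exact: complexI. Qed.

Lemma norm_normc (R : realType) (z : R[i]) (c : R) :
  normc z = c -> `|z| = c%:C.
Proof. by move=> <-. Qed.

Lemma conj_real (R : realType) (a : R) : (a%:C)^* = a%:C.
Proof. exact: conjc_real. Qed.

Lemma row_innerE (R : realType) (m n : nat) (A : 'M[R[i]]_(m, n)) i j :
  row_inner A i j = \sum_c A i c * (A j c)^*.
Proof.
by rewrite /row_inner dotmxE mxE; apply: eq_bigr => c _; rewrite !mxE.
Qed.

Lemma col_innerE (R : realType) (m n : nat) (A : 'M[R[i]]_(m, n)) i j :
  col_inner A i j = \sum_b A b i * (A b j)^*.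
Proof.
by rewrite /col_inner dotmxE mxE; apply: eq_bigr => c _; rewrite !mxE.
Qed.

Lemma adjmxE (R : realType) (m n : nat) (A : 'M[R[i]]_(m, n)) i j :
  (A ^t*) i j = (A j i)^*.
Proof. by rewrite !mxE. Qed.

Lemma adjmxZ (R : realType) (m n : nat) (a : R) (A : 'M[R[i]]_(m, n)) :
  (a%:C *: A) ^t* = a%:C *: A ^t*.
Proof. by apply/matrixP => i j; rewrite !mxE rmorphM /= conj_real. Qed.

Lemma adjmxB (R : realType) (m n : nat) (A B : 'M[R[i]]_(m, n)) :
  (A - B) ^t* = A ^t* - B ^t*.
Proof. by apply/matrixP => i j; rewrite !mxE rmorphB. Qed.

Lemma adjmxM (R : realType) (m n p : nat) (A : 'M[R[i]]_(m, n))
    (B : 'M[R[i]]_(n, p)) :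
  (A *m B) ^t* = B ^t* *m A ^t*.
Proof. by rewrite trmx_mul map_mxM. Qed.

Lemma sqr_l2norm (R : realType) (n : nat) (x : 'cV[R[i]]_n) :
  (l2norm x ^+ 2)%:C = (x ^t* *m x) 0 0.
Proof.
rewrite /l2norm sqr_sqrtr; last by apply: sumr_ge0 => i _; rewrite sqr_ge0.
rewrite mxE rmorph_sum; apply: eq_bigr => i _.
by rewrite !mxE mulrC -normCK rmorphXn.
Qed.

Lemma l2norm_ge0 (R : realType) (n : nat) (x : 'cV[R[i]]_n) : 0 <= l2norm x.
Proof. exact: sqrtr_ge0. Qed.

Lemma l2normE (R : realType) (n : nat) (x : 'cV[R[i]]_n) (c : R) :
  0 <= c -> (x ^t* *m x) 0 0 = (c ^+ 2)%:C -> l2norm x = c.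
Proof.
move=> c0; rewrite -sqr_l2norm => /complexI /eqP.
by rewrite eqrXn2 ?l2norm_ge0 // => /eqP.
Qed.

Lemma l2normZ (R : realType) (n : nat) (a : R) (x : 'cV[R[i]]_n) :
  0 <= a -> l2norm (a%:C *: x) = a * l2norm x.
Proof.
move=> a0; apply: l2normE; first by rewrite mulr_ge0 ?l2norm_ge0.
rewrite exprMn (rmorphM _ (a ^+ 2)) /= sqr_l2norm adjmxZ -scalemxAl -scalemxAr.
by rewrite scalerA mxE -rmorphM.
Qed.

Lemma sqr_l2norm_col (R : realType) (m n : nat) (A : 'M[R[i]]_(m, n)) j :
  (l2norm (col j A) ^+ 2)%:C = col_inner A j j.
Proof.
rewrite sqr_l2norm col_innerE mxE.
by apply: eq_bigr => b _; rewrite adjmxE !mxE mulrC.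
Qed.

Lemma sqr_l2norm_row (R : realType) (m n : nat) (A : 'M[R[i]]_(m, n)) i :
  (l2norm (row i A)^T ^+ 2)%:C = row_inner A i i.
Proof.
rewrite sqr_l2norm row_innerE mxE.
by apply: eq_bigr => c _; rewrite adjmxE !mxE mulrC.
Qed.

(** * Tight frames and coherence *)

Lemma tight_row_inner (R : realType) (M N : nat) (Phi : 'M[R[i]]_(M, N))
    (a : R) b b' :
  Phi *m Phi ^t* = (a%:C)%:M -> row_inner Phi b b' = a%:C * (b == b')%:R.
Proof.
move=> /matrixP/(_ b b'); rewrite mxE [RHS]mxE mulr_natr => <-.
by rewrite row_innerE; apply: eq_bigr => c _; rewrite adjmxE.
Qed.

Lemma tight_rank (R : realType) (M N : nat) (Phi : 'M[R[i]]_(M, N)) (a : R) :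
  0 < a -> Phi *m Phi ^t* = (a%:C)%:M -> \rank Phi = M.
Proof.
move=> a0 tightPhi; apply/eqP/row_freeP; exists (a^-1%:C *: Phi ^t*).
by rewrite -scalemxAr tightPhi scale_scalar_mx -rmorphM mulVf ?gt_eqF.
Qed.

(** With T = a^-1 Phi^* Phi, an orthogonal projection, the squared norm of
    x - T x is |x|^2 - a^-1 |Phi x|^2; the bound is its nonnegativity. *)
Lemma tight_le (R : realType) (M N : nat) (Phi : 'M[R[i]]_(M, N)) (a : R)
    (x : 'cV[R[i]]_N) :
  0 < a -> Phi *m Phi ^t* = (a%:C)%:M ->
  l2norm (Phi *m x) ^+ 2 <= a * l2norm x ^+ 2.
Proof.
move=> a0 tightPhi.
pose y := x - a^-1%:C *: (Phi ^t* *m (Phi *m x)).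
suff: l2norm y ^+ 2 = l2norm x ^+ 2 - a^-1 * l2norm (Phi *m x) ^+ 2.
  move=> E; rewrite -ler_pdivrMl // -subr_ge0 -E; exact: sqr_ge0.
apply: complexI; rewrite rmorphB (rmorphM _ a^-1) /= !sqr_l2norm.
have aV : a^-1%:C * a%:C = 1 :> R[i] by rewrite -rmorphM mulVf ?gt_eqF.
rewrite /y adjmxB adjmxZ !adjmxM trmxCK mulmxBl !mulmxBr.
rewrite -!scalemxAl -!scalemxAr !mulmxA.
rewrite -[_ *m Phi *m Phi ^t*]mulmxA tightPhi mul_mx_scalar -!scalemxAl.
by rewrite scalerA aV scale1r subrr subr0 !mxE.
Qed.

(** The bound of [tight_le] is attained at any vector in the range of Phi^*,
    since Phi (Phi^* e) = a e; the witness is Phi^* e for a basis vector e,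
    divided by its norm sqrt a. *)
Lemma tight_spectral_norm (R : realType) (M N : nat) (Phi : 'M[R[i]]_(M, N))
    (a : R) :
  (0 < M)%N -> 0 < a -> Phi *m Phi ^t* = (a%:C)%:M ->
  spectral_norm Phi = Num.sqrt a.
Proof.
move=> M0 a0 tightPhi.
have bound x : l2norm x <= 1 -> l2norm (Phi *m x) <= Num.sqrt a.
  move=> x1; rewrite -[leLHS]ger0_norm ?l2norm_ge0 // -sqrtr_sqr.
  apply/ler_wsqrtr/(le_trans (tight_le x a0 tightPhi)).
  by apply: ler_piMr; rewrite ?exprn_ile1 ?l2norm_ge0 // ltW.
apply/eqP; rewrite eq_le; apply/andP; split.
- apply: ge_sup; last by move=> _ [x /= x1 <-]; apply: bound.
  exists (l2norm (Phi *m 0)), 0 => //=.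
  by rewrite (@l2normE _ _ _ 0) // mulmx0 mxE expr0n.
- apply: ub_le_sup.
    by exists (Num.sqrt a) => _ [x /= x1 <-]; apply: bound.
  pose e : 'cV[R[i]]_M := delta_mx (Ordinal M0) 0.
  have e1 : l2norm e = 1.
    apply: l2normE => //; rewrite expr1n /e trmx_delta map_delta_mx.
    by rewrite mul_delta_mx mxE !eqxx.
  have s0 : 0 < Num.sqrt a by rewrite sqrtr_gt0.
  have ex : l2norm (Phi ^t* *m e) = Num.sqrt a.
    apply: l2normE; rewrite ?ltW // sqr_sqrtr ?ltW //.
    rewrite adjmxM trmxCK -mulmxA (mulmxA Phi) tightPhi.
    by rewrite mul_scalar_mx -scalemxAr mxE -sqr_l2norm e1 expr1n mulr1.
  exists ((Num.sqrt a)^-1%:C *: (Phi ^t* *m e)) => /=.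
    by rewrite l2normZ ?invr_ge0 ?(ltW s0) // ex mulVf ?gt_eqF.
  rewrite -scalemxAr mulmxA tightPhi mul_scalar_mx scalerA -rmorphM.
  rewrite l2normZ; last by rewrite mulr_ge0 ?invr_ge0 ?(ltW s0) ?(ltW a0).
  by rewrite e1 mulr1 -{2}(sqr_sqrtr (ltW a0)) expr2 mulKf ?gt_eqF.
Qed.

Lemma equiangular_coherence (R : realType) (M N : nat)
    (Phi : 'M[R[i]]_(M, N)) (c : R) :
  (1 < N)%N -> 0 <= c ->
  (forall i j, i != j -> normc (col_inner Phi i j) = c) ->
  worst_case_coherence Phi = c.
Proof.
move=> N1 c0 angle.
pose i0 := Ordinal (ltnW N1); pose i1 := Ordinal N1.
apply/eqP; rewrite eq_le; apply/andP; split.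
  apply: bigmax_le => // i _; apply: bigmax_le => // j ji.
  by rewrite angle // eq_sym.
by apply: (bigmax_sup i0) => //; apply: (bigmax_sup i1) => //; rewrite angle.
Qed.

(** Since the columns sum to 0, the inner products of phi_i with all columns,
    itself included, add up to 0; those with the others add up to -|phi_i|^2. *)
Lemma balanced_average_coherence (R : realType) (M N : nat)
    (Phi : 'M[R[i]]_(M, N)) :
  (1 < N)%N -> (forall j, l2norm (col j Phi) = 1) ->
  (forall b, \sum_j Phi b j = 0) ->
  average_coherence Phi = (N%:R - 1)^-1.
Proof.
move=> N1 unitPhi balanced.
have N10 : 0 < N%:R - 1 :> R by rewrite subr_gt0 ltr1n.
suff E i : normc ((N%:R - 1)^-1 * \sum_(j < N | j != i) col_inner Phi i j)
    = (N%:R - 1)^-1 :> R.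
  rewrite /average_coherence (eq_bigr (fun=> (N%:R - 1)^-1)) => [|i _];
    last exact: E.
  rewrite (bigmax_eq_arg _ (Ordinal N1)) // => i _.
  by rewrite invr_ge0 ltW.
have total : \sum_j col_inner Phi i j = 0.
  rewrite (eq_bigr _ (fun j _ => col_innerE Phi i j)) exchange_big.
  rewrite big1 //= => b _.
  by rewrite -mulr_sumr -rmorph_sum balanced rmorph0 mulr0.
have self : col_inner Phi i i = 1.
  by rewrite -sqr_l2norm_col unitPhi expr1n rmorph1.
have -> : \sum_(j < N | j != i) col_inner Phi i j = -1.
  move: total; rewrite (bigD1 i) //= self => /eqP.
  by rewrite addrC addr_eq0 => /eqP.
apply: normc_norm; rewrite mulrN1 normrN normfV fmorphV rmorphB rmorph1.
by rewrite rmorph_nat ger0_norm // subr_ge0 ler1n ltnW.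
Qed.

(** * Hadamard matrices *)

Lemma hadamard_rows (R : realType) (n : nat) (H : 'M[R[i]]_n) i i' :
  hadamard H -> \sum_c H i c * (H i' c)^* = n%:R * (i == i')%:R.
Proof.
move=> [uniH ortH]; rewrite -row_innerE.
have [->|/ortH->] := eqVneq i i'; last by rewrite mulr0.
rewrite row_innerE (eq_bigr (fun=> 1)).
  by rewrite mulr1 sumr_const card_ord.
by move=> c _; rewrite -normCK (norm_normc (uniH i' c)) expr1n.
Qed.

(** H H^* = n I gives H (H^* / n) = I; a one-sided inverse of a square matrix
    is two-sided, so the columns are orthogonal too. *)
Lemma hadamard_cols (R : realType) (n : nat) (H : 'M[R[i]]_n) c c' :
  hadamard H -> \sum_i H i c * (H i c')^* = n%:R * (c == c')%:R.
Proof.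
move=> hadH.
have n0 : n%:R != 0 :> R[i].
  by rewrite pnatr_eq0 -lt0n (leq_ltn_trans _ (ltn_ord c)).
have HH : H *m (n%:R^-1 *: H ^t*) = 1%:M.
  apply/matrixP => i i'; rewrite -scalemxAr !mxE.
  under eq_bigr do rewrite 2!mxE.
  by rewrite hadamard_rows // mulKf.
have /matrixP/(_ c' c) := mulmx1C HH.
rewrite -scalemxAl !mxE => /(canRL (mulVKf n0)).
under eq_bigr do rewrite !mxE mulrC.
by move=> ->; rewrite eq_sym.
Qed.

(** The sum of a row is its inner product with the all-ones row. *)
Lemma hadamard_row_sum (R : realType) (n : nat) (H : 'M[R[i]]_n) i0 i :
  hadamard H -> row i0 H = const_mx 1 -> i != i0 -> \sum_c H i c = 0.
Proof.
move=> hadH one /negPf ii0; have := hadamard_rows i i0 hadH.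
rewrite ii0 mulr0 => E; rewrite -[RHS]E; apply: eq_bigr => c _.
by have /rowP/(_ c) := one; rewrite !mxE => ->; rewrite rmorph1 mulr1.
Qed.

(** The all-ones row contributes 1 to the inner product of any two columns. *)
Lemma hadamard_cols_drop_ones (R : realType) (n : nat) (H : 'M[R[i]]_n)
    i0 c c' :
  hadamard H -> row i0 H = const_mx 1 ->
  \sum_(i | i != i0) H i c * (H i c')^* = n%:R * (c == c')%:R - 1.
Proof.
move=> hadH one; rewrite -(hadamard_cols c c' hadH) [in RHS](bigD1 i0) //=.
have o d : H i0 d = 1 by have /rowP/(_ d) := one; rewrite !mxE.
by rewrite !o rmorph1 mulr1 addrC addrK.
Qed.

(** * Columns of a block row *)

(** The cast is the one in [hconcat], so that it cancels in [hconcatE]; with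
    constant block width the dependent rank of [tagnat] is a bijection from
    pairs (block, column). *)
Definition hconcat_index (v n : nat) (j : 'I_v) (c : 'I_n) : 'I_(v * n) :=
  cast_ord (etrans (sum_nat_const 'I_v n) (congr1 (muln^~ n) (card_ord v)))
    (@tagnat.Rank v (fun=> n) j c).

Lemma hconcatE (R : realType) (m n v : nat) (A : 'I_v -> 'M[R[i]]_(m, n))
    b j c :
  hconcat A b (hconcat_index j c) = A j b c.
Proof.
rewrite /hconcat castmxE cast_ord_id /hconcat_index.
by rewrite cast_ordK mxE /tagnat.sig1 /tagnat.sig2 tagnat.rankK.
Qed.

Lemma hconcat_indexP (v n : nat) (i : 'I_(v * n)) :
  exists j c, i = hconcat_index j c.
Proof.
set e := etrans (sum_nat_const 'I_v n) (congr1 (muln^~ n) (card_ord v)).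
exists (tagnat.sig1 (cast_ord (esym e) i)), (tagnat.sig2 (cast_ord (esym e) i)).
by rewrite /hconcat_index tagnat.sig2K cast_ordKV.
Qed.

Lemma hconcat_index_inj (v n : nat) (j j' : 'I_v) (c c' : 'I_n) :
  hconcat_index j c = hconcat_index j' c' -> (j, c) = (j', c').
Proof.
move=> /cast_ord_inj/(congr1 (@tagnat.sig v (fun=> n))).
rewrite !tagnat.rankK.
by move/(congr1 (fun x : {_ : 'I_v & 'I_n} => (tag x, tagged x))).
Qed.

Lemma sum_hconcat (R : nmodType) (v n : nat) (F : 'I_(v * n) -> R) :
  \sum_i F i = \sum_j \sum_c F (hconcat_index j c).
Proof.
rewrite pair_bigA /=; apply: (reindex (fun p => hconcat_index p.1 p.2)).
apply: onW_bij; apply: inj_card_bij; last by rewrite card_prod !card_ord.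
by move=> [j c] [j' c'] /hconcat_index_inj.
Qed.

(** * Counts in a Steiner system *)

Section SteinerCounts.

Variables (R : realType) (k v : nat) (V : finType) (B : {set {set V}}).
Local Notation r := (replication k v).
Local Notation M := (num_blocks k v).
Local Notation N := (frame_size k v).
Hypothesis steinerB : steiner_system k v B.

Lemma block_size_gt1 : (1 < k)%N.
Proof. by have [/andP[]] := steinerB. Qed.

Lemma num_points_gt1 : (1 < v)%N.
Proof. by have [/andP[k1 kv] _ _ _] := steinerB; apply: leq_trans kv. Qed.

Lemma replicationM : (r * (k - 1) = v - 1)%N.
Proof.
have /card_gt0P[p _] : (0 < #|V|)%N.
  by have [_ -> _ _] := steinerB; exact: ltnW num_points_gt1.
by rewrite /replication divnK // (steiner_replicationE p steinerB).1.
Qed.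

Lemma replication_gt0 : (0 < r)%N.
Proof.
have := replicationM; have := num_points_gt1; case: (r) => //.
by rewrite mul0n => v1 /esym/eqP; rewrite subn_eq0 leqNgt v1.
Qed.

Lemma num_blocksM : (M * k = v * r)%N.
Proof.
have k1 : (0 < k - 1)%N by rewrite subn_gt0 block_size_gt1.
apply/eqP; rewrite -(eqn_pmul2r k1) -!mulnA replicationM.
by rewrite /num_blocks divnK // (steiner_num_blocksE steinerB).1.
Qed.

Lemma num_blocks_gt0 : (0 < M)%N.
Proof.
have := num_blocksM; case: (M) => //; rewrite mul0n => /esym/eqP.
by rewrite muln_eq0 !eqn0Ngt replication_gt0 (ltnW num_points_gt1).
Qed.

Lemma num_blocks_le : (M <= N)%N.
Proof.
apply: (@leq_trans (M * k)); first by rewrite leq_pmulr ?(ltnW block_size_gt1).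
by rewrite num_blocksM leq_mul2l leq_addl orbT.
Qed.

Lemma frame_size_gt1 : (1 < N)%N.
Proof.
by apply: leq_trans num_points_gt1 _; rewrite leq_pmulr.
Qed.

(** The counts as equations in [R], free of truncated subtraction and
    division: with them the numerical facts below become polynomial ones. *)
Let natrE : [/\ k%:R != 0 :> R, r%:R != 0 :> R, M%:R != 0 :> R &
  [/\ v%:R = r%:R * (k%:R - 1) + 1 :> R, M%:R * k%:R = v%:R * r%:R :> R
    & N%:R = v%:R * (1 + r%:R) :> R]].
Proof.
split; rewrite ?pnatr_eq0 -?lt0n ?replication_gt0 ?num_blocks_gt0 //.
  exact: ltnW block_size_gt1.
split; rewrite -?natrM ?num_blocksM //; last by rewrite /frame_size natrM natrD.
rewrite -[1]/1%:R -natrB ?(ltnW block_size_gt1) // -natrM replicationM.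
rewrite natrB ?subrK //.
exact: ltnW num_points_gt1.
Qed.

Lemma frame_redundancyE : N%:R / M%:R = k%:R * (1 + r%:R) / r%:R :> R.
Proof.
have [k0 r0 M0 [vE ME NE]] := natrE.
apply/eqP; rewrite eqr_div // NE; apply/eqP.
by rewrite [RHS]mulrC [RHS]mulrA ME; ring.
Qed.

(** After multiplication by k, both sides only involve M through M k = v r. *)
Lemma welch_boundE :
  (N%:R - M%:R) / (M%:R * (N%:R - 1)) = r%:R^-1 ^+ 2 :> R.
Proof.
have [k0 r0 M0 [vE ME NE]] := natrE.
have N1 : N%:R - 1 != 0 :> R.
  by rewrite subr_eq0 pnatr_eq1 gtn_eqF // frame_size_gt1.
rewrite exprVn -[RHS]div1r; apply/eqP.
rewrite eqr_div ?mulf_neq0 ?expf_neq0 //; apply/eqP.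
apply: (mulfI k0); transitivity ((N%:R * k%:R - M%:R * k%:R) * r%:R ^+ 2 : R).
  by ring.
transitivity (M%:R * k%:R * (N%:R - 1) : R); last by ring.
by rewrite ME NE vE; ring.
Qed.

(** Clearing denominators, r sqrt M <= N - 1 = r (k - 1 + v), so sqrt M <= v
    suffices, which follows from M k = v r and r < v. *)
Lemma average_boundE : (N%:R - 1)^-1 <= r%:R^-1 / Num.sqrt M%:R :> R.
Proof.
have [k0 r0 M0 [vE ME NE]] := natrE.
have rp : 0 < r%:R :> R by rewrite ltr0n replication_gt0.
have Mp : 0 < M%:R :> R by rewrite ltr0n num_blocks_gt0.
have N1 : 0 < N%:R - 1 :> R by rewrite subr_gt0 ltr1n frame_size_gt1.
rewrite -invfM lef_pV2 ?posrE ?mulr_gt0 ?sqrtr_gt0 //.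
have Mv : M%:R <= v%:R ^+ 2 :> R.
  rewrite -natrX ler_nat -(leq_pmul2r (ltnW block_size_gt1)) num_blocksM.
  rewrite expnS expn1 -mulnA leq_mul2l orbC.
  have := replicationM; have := block_size_gt1; have := num_points_gt1.
  by move: (r) => q; nia.
have NrE : N%:R - 1 = r%:R * (k%:R - 1 + v%:R) :> R by rewrite NE vE; ring.
rewrite NrE ler_pM2l //; apply: (@le_trans _ _ v%:R).
  by rewrite -[leRHS]ger0_norm // -sqrtr_sqr ler_wsqrtr.
by rewrite lerDr subr_ge0 ler1n (ltnW block_size_gt1).
Qed.

End SteinerCounts.

(** * The Gram matrices of the Steiner frame *)

Section SteinerFrame.

Variables (R : realType) (k v : nat) (V : finType) (B : {set {set V}}).
Variables (pt : 'I_v -> V) (bl : 'I_(num_blocks k v) -> {set V}).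
Local Notation r := (replication k v).
Local Notation M := (num_blocks k v).
Local Notation N := (frame_size k v).
Hypothesis steinerB : steiner_system k v B.
Hypothesis pt_bij : bijective pt.
Hypothesis bl_inj : injective bl.
Hypothesis bl_im : [set bl b | b : 'I_M] = B.

Let bl_in b : bl b \in B.
Proof. by rewrite -bl_im imset_f. Qed.

Lemma card_blocks_through j : #|[set b | pt j \in bl b]| = r.
Proof.
rewrite -(steiner_replicationE (pt j) steinerB).2 -(card_imset _ bl_inj).
apply: eq_card => X; rewrite !inE -bl_im; apply/imsetP/andP.
  by move=> [b]; rewrite inE => jb ->; rewrite imset_f.
by move=> [/imsetP[b _ ->] jb]; exists b; rewrite ?inE.
Qed.

Lemma card_points_of b : #|[set j | pt j \in bl b]| = k.
Proof.
have [_ _ hk _] := steinerB; rewrite -(hk _ (bl_in b)).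
rewrite -(card_imset _ (bij_inj pt_bij)); apply: eq_card => p.
have [pt' ptK pt'K] := pt_bij; apply/imsetP/idP.
  by move=> [j]; rewrite inE => jb ->.
by move=> pb; exists (pt' p); rewrite ?inE pt'K.
Qed.

Lemma joining_block j j' : j != j' ->
  exists b0, forall b, (pt j \in bl b) && (pt j' \in bl b) = (b == b0).
Proof.
move=> jj'; have [_ _ _ hP] := steinerB.
have /hP[X [[XB sX] uX]] : #|[set pt j; pt j']| = 2%N.
  by rewrite cards2 (inj_eq (bij_inj pt_bij)) jj'.
move: (XB) sX uX; rewrite -bl_im => /imsetP[b0 _ ->] sX uX.
exists b0 => b; apply/andP/eqP => [[jb j'b]|->].
  apply/bl_inj/esym/uX; split; first by rewrite bl_im.
  by rewrite finset.subUset !finset.sub1set jb.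
by move: sX; rewrite finset.subUset !finset.sub1set => /andP[].
Qed.

Variables (H : 'I_v -> 'M[R[i]]_(1 + r)) (f : 'I_v -> 'I_M -> 'I_(1 + r)).
Let A := incidence_mx R pt bl.
Let Phi := steiner_frame A H f.
Hypothesis hadH : forall j, hadamard (H j).
Hypothesis onesH : forall j, exists i, row i (H j) = const_mx 1.
Hypothesis admH : forall j, admissible_replacement (col j A^T) (H j) (f j).

Let s : R := Num.sqrt r%:R^-1.

Let sqr_s : s ^+ 2 = r%:R^-1.
Proof. by rewrite sqr_sqrtr ?invr_ge0. Qed.

Lemma steiner_frameE b j c :
  Phi b (hconcat_index j c) = s%:C * (H j (f j b) c *+ (pt j \in bl b)).
Proof.
rewrite /Phi /steiner_frame mxE hconcatE !mxE; congr (_%:C * _).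
  rewrite /s -(replicationM steinerB) natrM invfM mulrCA divff ?mulr1 //.
  by rewrite pnatr_eq0 -lt0n subn_gt0 (block_size_gt1 steinerB).
case: (pt j \in bl b); first by rewrite eqxx mxE mulr1n.
by rewrite eq_sym oner_eq0 mxE.
Qed.

Let incE j b : col j A^T b 0 = (pt j \in bl b)%:R.
Proof. by rewrite !mxE. Qed.

Lemma replacement_inj j : {in [set b | pt j \in bl b] &, injective (f j)}.
Proof.
move=> b b'; rewrite !inE => jb jb'; have [inj_f _] := admH j.
by apply: inj_f; rewrite incE ?jb ?jb'.
Qed.

Lemma replacement_neq_ones j i0 b : row i0 (H j) = const_mx 1 ->
  pt j \in bl b -> f j b != i0.
Proof.
move=> one jb; have [_ /(_ b)] := admH j; rewrite incE jb => /(_ erefl).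
by apply: contraNneq => ->; apply/eqP.
Qed.

(** The r blocks through the point receive distinct rows among the r rows
    that are not all-ones, so by counting every such row is used. *)
Lemma replacement_onto j i0 : row i0 (H j) = const_mx 1 ->
  f j @: [set b | pt j \in bl b] = [set~ i0].
Proof.
move=> one; apply/eqP; rewrite eqEcard; apply/andP; split.
  apply/fintype.subsetP => _ /imsetP[b + ->]; rewrite !inE.
  exact: replacement_neq_ones.
rewrite (card_in_imset (@replacement_inj j)) card_blocks_through.
by rewrite cardsC1 card_ord.
Qed.

Lemma steiner_row_sum b : \sum_i Phi b i = 0.
Proof.
rewrite sum_hconcat big1 // => j _.
rewrite (eq_bigr _ (fun c _ => steiner_frameE b j c)) -mulr_sumr.
case: (boolP (pt j \in bl b)) => [jb|_]; last by rewrite big1 ?mulr0.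
have [i0 one] := onesH j.
by rewrite (hadamard_row_sum (hadH j) one) ?mulr0 // replacement_neq_ones.
Qed.

(** In the slice of point j the rows of b and b' overlap only if j lies on both
    blocks, and then their inner product is that of rows [f j b] and [f j b'] of
    [H j]: r + 1 if b = b' and 0 otherwise. Each of the k points of b
    contributes. *)
Lemma steiner_tight : Phi *m Phi ^t* = ((N%:R / M%:R : R)%:C)%:M.
Proof.
apply/matrixP => b b'; rewrite mxE [RHS]mxE sum_hconcat.
transitivity (\sum_(j | pt j \in bl b)
    (r%:R^-1 * (1 + r)%:R : R)%:C * (b == b')%:R).
  rewrite [RHS]big_mkcond; apply: eq_bigr => j _.
  transitivity (s%:C ^+ 2 * \sum_c (H j (f j b) c *+ (pt j \in bl b)) *
      (H j (f j b') c *+ (pt j \in bl b'))^*).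
    rewrite mulr_sumr; apply: eq_bigr => c _; rewrite adjmxE !steiner_frameE.
    by rewrite rmorphM /= conj_real mulrACA -expr2.
  case: ifPn => jb; last by rewrite big1 ?mulr0 // => c _; rewrite mul0r.
  case: (boolP (pt j \in bl b')) => jb'.
    under eq_bigr do rewrite !mulr1n.
    rewrite (hadamard_rows _ _ (hadH j)).
    rewrite (inj_in_eq (@replacement_inj j)) ?inE // mulrA.
    by rewrite rmorphM /= -rmorphXn sqr_s rmorph_nat.
  rewrite big1 ?mulr0; last by move=> c _; rewrite mulr0n rmorph0 mulr0.
  by case: eqVneq jb' => [<-|]; rewrite ?jb ?mulr0.
rewrite sumr_const -(cardsE [pred j | pt j \in bl b]) card_points_of.
case: (b == b'); last by rewrite mulr0 mul0rn.
rewrite mulr1 -rmorphMn (frame_redundancyE R steinerB); congr _%:C.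
by rewrite natrD mulrC -mulr_natl mulrA.
Qed.

(** The blocks through j enumerate the rows of [H j] other than the all-ones
    one ([replacement_onto]), so the sum over blocks is the inner product of two
    columns of [H j] with that row removed. *)
Lemma steiner_col_inner_same j c c' :
  col_inner Phi (hconcat_index j c) (hconcat_index j c') =
  r%:R^-1 * ((1 + r)%:R * (c == c')%:R - 1).
Proof.
have [i0 one] := onesH j.
rewrite col_innerE -(hadamard_cols_drop_ones c c' (hadH j) one).
rewrite (eq_bigl (mem [set~ i0])); last by move=> i; rewrite !inE.
rewrite -(replacement_onto one) big_imset /=; last exact: replacement_inj.
rewrite mulr_sumr [RHS]big_mkcond; apply: eq_bigr => b _.
rewrite inE !steiner_frameE; case: ifP => _; last by rewrite mulr0 mul0r.
rewrite rmorphM /= conj_real mulrACA -expr2 -rmorphXn sqr_s.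
by rewrite fmorphV rmorph_nat.
Qed.

(** Only the block joining the two points contributes, with one product of
    unimodular entries. *)
Lemma steiner_col_inner_diff j j' c c' : j != j' ->
  normc (col_inner Phi (hconcat_index j c) (hconcat_index j' c')) = r%:R^-1.
Proof.
move=> jj'; have [b0 joinE] := joining_block jj'.
rewrite col_innerE (bigD1 b0) //= big1 ?addr0.
  rewrite !steiner_frameE; have := joinE b0; rewrite eqxx => /andP[-> ->].
  rewrite rmorphM /= conj_real mulrACA -expr2 -rmorphXn sqr_s.
  apply: normc_norm; rewrite !normrM norm_conjC.
  rewrite !(norm_normc ((hadH _).1 _ _)) !mulr1 ger0_norm //.
  by rewrite lecR invr_ge0.
move=> b bb0; rewrite !steiner_frameE.
have := joinE b; rewrite (negPf bb0) => /negbT; rewrite negb_and.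
by case/orP => /negPf ->; rewrite mulr0n mulr0 ?mul0r // rmorph0 mulr0.
Qed.

Lemma steiner_unit i : l2norm (col i Phi) = 1.
Proof.
have [j [c ->]] := hconcat_indexP i.
apply: l2normE => //; rewrite -sqr_l2norm sqr_l2norm_col expr1n rmorph1.
rewrite steiner_col_inner_same eqxx mulr1 natrD addrC addKr mulVf //.
by rewrite pnatr_eq0 -lt0n (replication_gt0 steinerB).
Qed.

Lemma steiner_equiangular i i' : i != i' ->
  normc (col_inner Phi i i') = r%:R^-1.
Proof.
have [j [c ->]] := hconcat_indexP i; have [j' [c' ->]] := hconcat_indexP i'.
have [<-{j'}|jj' _] := eqVneq j j'; last exact: steiner_col_inner_diff.
have [->|cc' _] := eqVneq c c'; first by rewrite eqxx.
rewrite steiner_col_inner_same (negPf cc') mulr0 sub0r mulrN1.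
apply: normc_norm; rewrite normrN normfV normr_nat.
by rewrite fmorphV rmorph_nat.
Qed.

End SteinerFrame.

(** * Steiner equiangular tight frames *)

Theorem theorem58 (R : realType) (k v : nat) (V : finType) (B : {set {set V}})
    (pt : 'I_v -> V) (bl : 'I_(num_blocks k v) -> {set V})
    (H : 'I_v -> 'M[R[i]]_(1 + replication k v))
    (f : 'I_v -> 'I_(num_blocks k v) -> 'I_(1 + replication k v)) :
  let M := num_blocks k v in
  let N := frame_size k v in
  let A := incidence_mx R pt bl in
  let Phi := steiner_frame A H f in
  let mu := worst_case_coherence Phi in
  steiner_system k v B ->
  bijective pt ->
  injective bl -> [set bl b | b : 'I_M] = B ->
  (forall j, hadamard (H j)) ->
  (forall j, exists i, row i (H j) = const_mx 1) ->
  (forall j, admissible_replacement (col j A^T) (H j) (f j)) ->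
  [/\ equiangular_tight_frame Phi,
      spectral_norm Phi ^+ 2 = N%:R / M%:R,
      mu ^+ 2 = (N%:R - M%:R) / (M%:R * (N%:R - 1))
    & average_coherence Phi <= mu / Num.sqrt M%:R].
Proof.
move=> M N A Phi mu steinerB pt_bij bl_inj bl_im hadH onesH admH.
have tightPhi := steiner_tight steinerB pt_bij bl_im hadH admH.
have unitPhi := steiner_unit steinerB bl_inj bl_im hadH onesH admH.
have angle := steiner_equiangular steinerB pt_bij bl_inj bl_im hadH onesH admH.
have N1 : (1 < N)%N := frame_size_gt1 steinerB.
have M0 : (0 < M)%N := num_blocks_gt0 steinerB.
have a0 : 0 < N%:R / M%:R :> R by rewrite divr_gt0 ?ltr0n // ltnW.
have muE : mu = (replication k v)%:R^-1.
  by apply: equiangular_coherence; rewrite ?invr_ge0.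
split.
- split=> //.
  + by rewrite (tight_rank a0 tightPhi) (minn_idPl (num_blocks_le steinerB)).
  + move=> i i' /negPf ii'.
    by rewrite (tight_row_inner i i' tightPhi) ii' mulr0.
  + exists (Num.sqrt (N%:R / M%:R)) => i.
    apply: l2normE; rewrite ?sqrtr_ge0 // sqr_sqrtr ?ltW //.
    rewrite -sqr_l2norm sqr_l2norm_row (tight_row_inner i i tightPhi).
    by rewrite eqxx mulr1.
  + by exists (replication k v)%:R^-1.
- by rewrite (tight_spectral_norm M0 a0 tightPhi) sqr_sqrtr // ltW.
- by rewrite muE (welch_boundE R steinerB).
- rewrite (balanced_average_coherence N1 unitPhi); last first.
    exact: (steiner_row_sum steinerB hadH onesH admH).
  by rewrite muE (average_boundE R steinerB).
Qed.
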